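(* Let $\otimes_\alpha$ be a tensor product (of order $l$) of convex bodies with zero in the interior, and let $\otimes_{\alpha'}$ be its dual tensor product. Then $\otimes_\alpha$ is projective if and only if $\otimes_{\alpha'}$ is injective.
   Context: A Euclidean space is a finite dimensional real inner product space; $\mathbb{E}_i,\mathbb{F}_i$ denote Euclidean spaces. $\otimes_{i=1}^l\mathbb{E}_i$ carries the scalar product determined by $\langle x^1\otimes\cdots\otimes x^l,y^1\otimes\cdots\otimes y^l\rangle_H=\prod_i\langle x^i,y^i\rangle_{\mathbb{E}_i}$. A convex body is a compact convex set with nonempty interior. The polar of $C$ is $C^\circ=\{y:\sup_{x\in C}\langle x,y\rangle\le1\}$ (with respect to $\langle\cdot,\cdot\rangle_H$ in tensor product spaces). For convex bodies $P_i\subset\mathbb{E}_i$ with $0$ in the interior, $P_1\otimes_\pi\cdots\otimes_\pi P_l:=\mathrm{conv}\{x^1\otimes\cdots\otimes x^l:x^i\in P_i\}$ and $P_1\otimes_\epsilon\cdots\otimes_\epsilon P_l:=(P_1^\circ\otimes_\pi\cdots\otimes_\pi P_l^\circ)^\circ$. A tensor product $\otimes_\alpha$ of order $l$ of convex bodies with zero in the interior assigns to each $l$-tuple of convex bodies $P_i\subset\mathbb{E}_i$ containing $0$ in the interior a convex body $P_1\otimes_\alpha\cdots\otimes_\alpha P_l\subset\otimes_{i=1}^l\mathbb{E}_i$ such that (1) $P_1\otimes_\pi\cdots\otimes_\pi P_l\subseteq P_1\otimes_\alpha\cdots\otimes_\alpha P_l\subseteq P_1\otimes_\epsilon\cdots\otimes_\epsilon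 P_l$; (2) (uniform property) for all linear $T_i:\mathbb{E}_i\to\mathbb{F}_i$ and convex bodies $Q_i\subset\mathbb{F}_i$ with $0$ in the interior and $T_i(P_i)\subseteq Q_i$, $T_1\otimes\cdots\otimes T_l(P_1\otimes_\alpha\cdots\otimes_\alpha P_l)\subseteq Q_1\otimes_\alpha\cdots\otimes_\alpha Q_l$. The dual tensor product is $P_1\otimes_{\alpha'}\cdots\otimes_{\alpha'}P_l:=(P_1^\circ\otimes_\alpha\cdots\otimes_\alpha P_l^\circ)^\circ$. $\otimes_\alpha$ is injective if $(P_1\cap M_1)\otimes_\alpha\cdots\otimes_\alpha(P_l\cap M_l)=(P_1\otimes_\alpha\cdots\otimes_\alpha P_l)\cap\otimes_{i=1}^l M_i$ for all convex bodies $P_i\subset\mathbb{E}_i$ with $0\in\mathrm{int}(P_i)$ and all subspaces $M_i\subseteq\mathbb{E}_i$ (with the induced scalar product). $\otimes_\alpha$ is projective if $T_1\otimes\cdots\otimes T_l(P_1\otimes_\alpha\cdots\otimes_\alpha P_l)=T_1P_1\otimes_\alpha\cdots\otimes_\alpha T_lP_l$ for all convex bodies $P_i\subset\mathbb{E}_i$ with $0\in\mathrm{int}(P_i)$ and all surjective linear maps $T_i:\mathbb{E}_i\to\mathbb{F}_i$. *)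

(* Defs.v *)
From HB Require Import structures.
From mathcomp Require Import all_boot all_order all_algebra.
From mathcomp Require Import all_classical all_reals.
From mathcomp Require Import ereal topology normedtype convex.
From mathcomp Require Import ring.

Set Implicit Arguments.
Unset Strict Implicit.
Unset Printing Implicit Defensive.

Import Order.TTheory GRing.Theory Num.Theory.
Import numFieldNormedType.Exports.

Local Open Scope classical_set_scope.
Local Open Scope ring_scope.

(* The topology of a Euclidean space is the one of the norm of its scalar
   product; the factory Vector_isEuclidean below builds it from the scalar
   product alone. *)
HB.mixin Record isEuclidean (R : realType) E
    & NormedModule R E & Vector R E := {
  inner : {dot E for idfun} ;
  inner_normE : forall x : E, inner x x = `|x| ^+ 2
}.

#[short(type="euclideanType")]
HB.structure Definition Euclidean (R : realType) :=
  {E of NormedModule R E & Vector R E & isEuclidean R E}.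

Notation "''[' x , y ]" := (inner x y) : ring_scope.

HB.factory Record Vector_isEuclidean (R : realType) E & Vector R E := {
  dotp : {dot E for idfun}
}.

HB.builders Context R E & Vector_isEuclidean R E.

Let norm (x : E) : R := Num.sqrt (dotp x x).

Let dotC (x y : E) : dotp x y = dotp y x.
Proof. by rewrite hermitian_subproof /= expr0 mul1r. Qed.

Let dot_ge0 (x : E) : 0 <= dotp x x.
Proof.
have [->|x0] := eqVneq x 0; first by rewrite linear0r.
by rewrite ltW// neq0_dnorm_gt0.
Qed.

Let sqr_norm x : norm x ^+ 2 = dotp x x.
Proof. by rewrite sqr_sqrtr. Qed.

Let norm_ge0 x : 0 <= norm x.
Proof. exact: sqrtr_ge0. Qed.

Let cauchy_schwarz (x y : E) : dotp x y <= norm x * norm y.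
Proof.
have [->|y0] := eqVneq y 0; first by rewrite linear0r mulr_ge0.
have yy : 0 < dotp y y by exact: neq0_dnorm_gt0.
rewrite (le_trans (ler_norm _))//.
rewrite -(@ler_pXn2r _ 2)// ?nnegrE ?mulr_ge0//.
rewrite exprMn !sqr_norm real_normK ?num_real//.
have := dot_ge0 (dotp y y *: x - dotp x y *: y).
rewrite linearBl !linearBr !linearZl_LR !linearZr_LR /= (dotC y x).
set a := dotp x x; set b := dotp x y; set c := dotp y y.
have -> : c * (c * a) - c * (b * b) - (b * (c * b) - b * (b * c)) =
  c * (a * c - b ^+ 2) by ring.
by rewrite pmulr_rge0// subr_ge0.
Qed.

Let ler_normD (x y : E) : norm (x + y) <= norm x + norm y.
Proof.
rewrite -(@ler_pXn2r _ 2)// ?nnegrE ?addr_ge0//.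
rewrite sqrrD !sqr_norm.
have -> : dotp (x + y) (x + y) =
    dotp x x + dotp x y + (dotp x y + dotp y y).
  by rewrite linearDl !linearDr /=; congr (_ + _ + (_ + _)); exact: dotC.
have := cauchy_schwarz x y; set a := dotp x y; set b := norm x * norm y => ab.
have -> : dotp x x + a + (a + dotp y y) = dotp x x + a *+ 2 + dotp y y by ring.
by rewrite lerD2r lerD2l lerMn2r ab orbT.
Qed.

Let normrZ (l : R) (x : E) : norm (l *: x) = `|l| * norm x.
Proof.
rewrite /norm linearZl_LR linearZr_LR /= mulrA -expr2 sqrtrM ?sqr_ge0//.
by rewrite sqrtr_sqr.
Qed.

Let normr0_eq0 (x : E) : norm x = 0 -> x = 0.
Proof.
move=> x0; have := sqr_norm x; rewrite x0 expr0n /=.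
by have [//|/(neq0_dnorm_gt0 (s := dotp))/gt_eqF/eqP xx /esym] := eqVneq x 0.
Qed.

HB.instance Definition _ :=
  Lmodule_isNormed.Build R E ler_normD normrZ normr0_eq0.

HB.instance Definition _ := isEuclidean.Build R E (fun x => esym (sqr_norm x)).

HB.end.

Section EuclideanTheory.
Variables (R : realType) (E : euclideanType R).
Implicit Types x y : E.

Lemma innerC x y : '[x, y] = '[y, x].
Proof. by rewrite hermitian_subproof /= expr0 mul1r. Qed.

Lemma innerDl x y z : '[x + y, z] = '[x, z] + '[y, z].
Proof. exact: linearDl. Qed.

Lemma innerZl a x y : '[a *: x, y] = a * '[x, y].
Proof. exact: linearZl_LR. Qed.

Lemma innerDr x y z : '[x, y + z] = '[x, y] + '[x, z].
Proof. exact: linearDr. Qed.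

Lemma innerBl x y z : '[x - y, z] = '[x, z] - '[y, z].
Proof. exact: linearBl. Qed.

Lemma innerBr x y z : '[x, y - z] = '[x, y] - '[x, z].
Proof. exact: linearBr. Qed.

Lemma innerZr a x y : '[x, a *: y] = a * '[x, y].
Proof. exact: linearZr_LR. Qed.

Lemma inner_suml I (r : seq I) (P : pred I) (f : I -> E) y :
  '[\sum_(i <- r | P i) f i, y] = \sum_(i <- r | P i) '[f i, y].
Proof. exact: linear_sumlz. Qed.

Lemma inner_sumr I (r : seq I) (P : pred I) (f : I -> E) y :
  '[y, \sum_(i <- r | P i) f i] = \sum_(i <- r | P i) '[y, f i].
Proof. exact: linear_sumr. Qed.

Lemma inner_gt0 x : x != 0 -> 0 < '[x, x].
Proof. exact: neq0_dnorm_gt0. Qed.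

End EuclideanTheory.

Section Subspace.
Variables (R : realType) (E : euclideanType R) (M : {vspace E}).

Definition sub_inner (x y : subvs_of M) : R := '[vsval x, vsval y].

Let sub_innerDl y : zmod_morphism (sub_inner^~ y).
Proof. by move=> x z; rewrite /sub_inner raddfB; exact: innerBl. Qed.

Let sub_innerDr x : zmod_morphism (sub_inner x).
Proof. by move=> y z; rewrite /sub_inner !raddfB. Qed.

Let sub_innerZl y : scalable_for *%R (sub_inner^~ y).
Proof. by move=> a x; rewrite /sub_inner linearZ; exact: innerZl. Qed.

Let sub_innerZr x : scalable_for (idfun \; *%R) (sub_inner x).
Proof. by move=> a y; rewrite /sub_inner !linearZ. Qed.

HB.instance Definition _ := isBilinear.Build R (subvs_of M) (subvs_of M) R
  *%R (idfun \; *%R) sub_inner sub_innerDl sub_innerDr sub_innerZl sub_innerZr.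

Let sub_inner_sym x y : sub_inner x y = (-1) ^+ false * idfun (sub_inner y x).
Proof. by rewrite /= expr0 mul1r /sub_inner innerC. Qed.

HB.instance Definition _ := isHermitianSesquilinear.Build R (subvs_of M)
  false idfun sub_inner sub_inner_sym.

Let sub_inner_gt0 x : x != 0 -> 0 < sub_inner x x.
Proof. by move=> x0; apply: inner_gt0; rewrite raddf_eq0 //; exact: subvs_inj. Qed.

HB.instance Definition _ :=
  isDotProduct.Build R (subvs_of M) sub_inner sub_inner_gt0.

HB.instance Definition _ := Vector_isEuclidean.Build R (subvs_of M)
  (sub_inner : {dot subvs_of M for idfun}).

Lemma sub_innerE (x y : subvs_of M) : '[x, y] = '[vsval x, vsval y].
Proof. by []. Qed.

End Subspace.

Section OrthonormalBasis.
Variables (R : realType) (E : euclideanType R).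

Lemma orthonormal_exists n : (n <= \dim {:E})%N ->
  exists e : 'I_n -> E, forall i j, '[e i, e j] = (i == j)%:R.
Proof.
elim: n => [_|n IHn ltn].
  by exists (fun=> 0) => -[].
have [e eP] := IHn (ltnW ltn).
have [v vn] : exists v : E, v \notin <<[seq e i | i <- enum 'I_n]>>%VS.
  apply: contrapT => /forallNP h; have : (\dim {:E} <= n)%N.
    rewrite -[X in (_ <= X)%N](size_enum_ord n) -(size_map e).
    rewrite (leq_trans _ (dim_span _))// dimvS//.
    by apply/subvP => v _; apply/negPn/negP; exact: h.
  by rewrite leqNgt ltn.
pose w := v - \sum_i '[v, e i] *: e i.
have w0 : w != 0.
  apply: contraNneq vn => /subr0_eq ->; apply: memv_suml => i _.
  by apply/memvZ/memv_span/map_f; rewrite mem_enum.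
have we i : '[w, e i] = 0.
  rewrite /w innerBl inner_suml (bigD1 i)//= big1 => [|j ji].
    by rewrite addr0 innerZl eP eqxx mulr1 subrr.
  by rewrite innerZl eP (negbTE ji) mulr0.
pose u := (Num.sqrt '[w, w])^-1 *: w.
exists (fun i => if unlift ord_max i is Some j then e j else u) => i j.
case: unliftP => [i' ->|->]; case: unliftP => [j' ->|->].
- by rewrite eP (inj_eq lift_inj).
- by rewrite innerC innerZl we mulr0 eq_sym (negbTE (neq_lift _ _)).
- by rewrite innerZl we mulr0 (negbTE (neq_lift _ _)).
rewrite eqxx innerZl innerC innerZl mulrA -expr2 exprVn.
rewrite sqr_sqrtr; last by rewrite ltW ?inner_gt0.
by rewrite mulVf// gt_eqF ?inner_gt0.
Qed.

Definition onb : 'I_(\dim {:E}) -> E := sval (cid (orthonormal_exists (leqnn _))).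

Lemma onbP i j : '[onb i, onb j] = (i == j)%:R.
Proof. exact: (svalP (cid (orthonormal_exists (leqnn _)))). Qed.

Lemma onb_sum x : x = \sum_i '[x, onb i] *: onb i.
Proof.
pose X := [tuple onb i | i < \dim {:E}].
have Xi (i : 'I_(\dim {:E})) : X`_i = onb i by rewrite -tnth_nth tnth_mktuple.
have freeX : free X.
  apply/freeP => k k0 i; have := congr1 (fun z => '[z, onb i]) k0.
  rewrite linear0l inner_suml (bigD1 i)//= big1 => [|j ji].
    by rewrite Xi innerZl onbP eqxx mulr1 addr0.
  by rewrite Xi innerZl onbP (negbTE ji) mulr0.
have /coord_span xX : x \in <<X>>%VS.
  have := basisEfree X {:E}; rewrite freeX subvf size_tuple leqnn /= => /span_basis ->.
  exact: memvf.
have xi i : '[x, onb i] = coord X i x.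
  rewrite {1}xX inner_suml (bigD1 i)//= big1 => [|j ji].
    by rewrite Xi innerZl onbP eqxx mulr1 addr0.
  by rewrite Xi innerZl onbP (negbTE ji) mulr0.
by rewrite {1}xX; apply: eq_bigr => i _; rewrite xi Xi.
Qed.

Lemma inner_onb x y : '[x, y] = \sum_i '[x, onb i] * '[y, onb i].
Proof.
rewrite {1}(onb_sum x) inner_suml; apply: eq_bigr => i _.
by rewrite innerZl [X in _ * X]innerC.
Qed.

End OrthonormalBasis.

Section Tensor.
Variables (R : realType) (l : nat) (E : 'I_l -> euclideanType R).

Definition tensor_index := {dffun forall i : 'I_l, 'I_(\dim {:E i})}.

(* The tensor product of the E i, in coordinates: z j is the scalar product of
   z with the tensor of the basis vectors onb (j i). Up to isometry it does not
   depend on the bases, by inner_pure and tensor_sum_pure. *)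
Definition tensor := {ffun tensor_index -> R^o}.

HB.instance Definition _ := Vector.on tensor.

Definition tensor_inner (z w : tensor) : R := \sum_j z j * w j.

Let tensor_innerDl w : zmod_morphism (tensor_inner^~ w).
Proof.
move=> z z'; rewrite /tensor_inner -sumrB; apply: eq_bigr => j _.
by rewrite !ffunE mulrBl.
Qed.

Let tensor_innerC z w : tensor_inner z w = tensor_inner w z.
Proof. by apply: eq_bigr => j _; rewrite mulrC. Qed.

Let tensor_innerDr z : zmod_morphism (tensor_inner z).
Proof. by move=> w w'; rewrite !(tensor_innerC z) tensor_innerDl. Qed.

Let tensor_innerZl w : scalable_for *%R (tensor_inner^~ w).
Proof.
move=> a z; rewrite /tensor_inner mulr_sumr; apply: eq_bigr => j _.
by rewrite !ffunE mulrA.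
Qed.

Let tensor_innerZr z : scalable_for (idfun \; *%R) (tensor_inner z).
Proof. by move=> a w; rewrite !(tensor_innerC z) tensor_innerZl. Qed.

HB.instance Definition _ := isBilinear.Build R tensor tensor R
  *%R (idfun \; *%R) tensor_inner
  tensor_innerDl tensor_innerDr tensor_innerZl tensor_innerZr.

Let tensor_inner_sym z w :
  tensor_inner z w = (-1) ^+ false * idfun (tensor_inner w z).
Proof. by rewrite /= expr0 mul1r. Qed.

HB.instance Definition _ := isHermitianSesquilinear.Build R tensor
  false idfun tensor_inner tensor_inner_sym.

Let tensor_inner_gt0 z : z != 0 -> 0 < tensor_inner z z.
Proof.
move=> z0; rewrite lt_def sumr_ge0 ?andbT; last by move=> j _; rewrite -expr2 sqr_ge0.
apply: contra z0 => /eqP/psumr_eq0P zz; apply/eqP/ffunP => j; rewrite ffunE.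
have /eqP := zz (fun j _ => sqr_ge0 (z j)) j isT.
by rewrite mulf_eq0 orbb => /eqP.
Qed.

HB.instance Definition _ :=
  isDotProduct.Build R tensor tensor_inner tensor_inner_gt0.

HB.instance Definition _ := Vector_isEuclidean.Build R tensor
  (tensor_inner : {dot tensor for idfun}).

Definition pure (x : forall i, E i) : tensor :=
  [ffun j : tensor_index => \prod_i '[x i, onb (j i)]].

Lemma pureE x (j : tensor_index) : pure x j = \prod_i '[x i, onb (j i)].
Proof. by rewrite ffunE. Qed.

Lemma tensor_innerE (z w : tensor) : '[z, w] = \sum_j z j * w j.
Proof. by []. Qed.

Lemma sum_prod_tensor_index (f : forall i, 'I_(\dim {:E i}) -> R) :
  \sum_(j : tensor_index) \prod_i f i (j i) = \prod_i \sum_k f i k.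
Proof.
rewrite (reindex (@dffun_of_fprod _ _)); last exact/onW_bij/dffun_of_fprod_bij.
under eq_bigr do under eq_bigr do rewrite ffunE -[f _ _](ffunE (f _)).
rewrite (big_fprod _ _ (fun i => [ffun k => f i k])).
under [RHS]eq_bigr do under eq_bigr do rewrite -[f _ _](ffunE (f _)).
under [RHS]eq_bigr => i _ do rewrite (big_tag (fun i => [ffun k => f i k])).
by rewrite bigA_distr_big_dep.
Qed.

Lemma inner_pure x y : '[pure x, pure y] = \prod_i '[x i, y i].
Proof.
under [RHS]eq_bigr do rewrite inner_onb.
rewrite -sum_prod_tensor_index tensor_innerE; apply: eq_bigr => j _.
by rewrite !pureE -big_split.
Qed.

Lemma pure_onb (j k : tensor_index) : pure (fun i => onb (j i)) k = (j == k)%:R.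
Proof.
rewrite pureE; under eq_bigr do rewrite onbP.
have [->|jk] := eqVneq j k; first by rewrite big1 // => i _; rewrite eqxx.
have [i ji] : exists i, j i != k i.
  apply/existsP; apply: contraNT jk; rewrite negb_exists => /forallP jk.
  by apply/eqP/ffunP => i; apply/eqP; have := jk i; rewrite negbK.
by rewrite (bigD1 i)//= (negbTE ji) mul0r.
Qed.

Lemma tensor_sum_pure (z : tensor) :
  z = \sum_j z j *: pure (fun i => onb (j i)).
Proof.
apply/ffunP => k; rewrite sum_ffunE (bigD1 k)//= ffunE pure_onb eqxx.
rewrite big1 ?addr0; first by rewrite /GRing.scale /= mulr1.
by move=> j jk; rewrite ffunE pure_onb (negbTE jk) scaler0.
Qed.

End Tensor.

Section TensorMap.
Variables (R : realType) (l : nat) (E F : 'I_l -> euclideanType R).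
Variable T : forall i, {linear E i -> F i}.

(* Linear extension from the basis pure (fun i => onb (j i)); independence from
   the choice of bases follows from tensor_map_pure and tensor_sum_pure. *)
Definition tensor_map (z : tensor E) : tensor F :=
  \sum_j z j *: pure (fun i => T i (onb (j i))).

Let tensor_map_linear : linear tensor_map.
Proof.
move=> a z w; rewrite /tensor_map scaler_sumr -big_split; apply: eq_bigr => j _.
by rewrite !ffunE scalerDl scalerA.
Qed.

HB.instance Definition _ :=
  GRing.isLinear.Build R (tensor E) (tensor F) _ tensor_map tensor_map_linear.

Lemma tensor_map_pure (x : forall i, E i) :
  tensor_map (pure x) = pure (fun i => T i (x i)).
Proof.
apply/ffunP => k; rewrite sum_ffunE.
under eq_bigr do rewrite ffunE !pureE.
under eq_bigr do rewrite /GRing.scale /= -big_split /=.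
rewrite pureE (sum_prod_tensor_index (fun i m => '[x i, onb m] * '[T i (onb m), onb (k i)])).
apply: eq_bigr => i _; rewrite [in RHS](onb_sum (x i)) raddf_sum inner_suml.
by apply: eq_bigr => m _; rewrite -innerZl; congr ('[_, _]); exact/esym/linearZ_LR.
Qed.

End TensorMap.

Section TensorSubspace.
Variables (R : realType) (l : nat) (E : 'I_l -> euclideanType R).
Variable M : forall i, {vspace E i}.

Definition sub_spaces (i : 'I_l) : euclideanType R := subvs_of (M i).

Definition tensor_incl : tensor sub_spaces -> tensor E :=
  tensor_map (fun i => @vsval _ _ (M i)).

(* The linear span of the tensors of vectors of the M i; tensor_subE and
   inner_tensor_incl identify it isometrically with tensor sub_spaces. *)
Definition tensor_sub : set (tensor E) :=
  [set z | forall V : {vspace tensor E},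
    (forall x, (forall i, x i \in M i) -> pure x \in V) -> z \in V].

Lemma tensor_subE : tensor_sub = range tensor_incl.
Proof.
apply/seteqP; split => [z zM|_ [z _ <-] V MV].
  have : z \in limg (linfun tensor_incl).
    apply: zM => x xM.
    have -> : pure x = linfun tensor_incl
        (pure (fun i => Subvs (xM i) : sub_spaces i)).
      by rewrite lfunE; exact/esym/tensor_map_pure.
    by rewrite memv_img ?memvf.
  by case/memv_imgP => w _ ->; exists w => //; rewrite lfunE.
rewrite /tensor_incl /tensor_map; apply: memv_suml => j _; apply: memvZ.
by apply: MV => i; exact: subvsP.
Qed.

Lemma inner_tensor_incl z w : '[tensor_incl z, tensor_incl w] = '[z, w].
Proof.
rewrite {1 2}/tensor_incl /tensor_map [in RHS](tensor_sum_pure z).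
rewrite [in RHS](tensor_sum_pure w) !inner_suml; apply: eq_bigr => j _.
rewrite !inner_sumr; apply: eq_bigr => k _.
by rewrite !innerZl !innerZr !inner_pure.
Qed.

End TensorSubspace.

Section ConvexBodies.
Variables (R : realType) (E : euclideanType R).
Implicit Types C P : set E.

Definition convex_body C := [/\ convex_set C, compact C & C° !=set0].

Definition convex_body0 C := convex_body C /\ C° 0.

Definition convex_hull C : set E := smallest (@convex_set R E) C.

Definition polar C : set E :=
  [set y | (ereal_sup [set '[x, y]%:E | x in C] <= 1)%E].

Lemma polarP C y : polar C y <-> forall x, C x -> '[x, y] <= 1.
Proof.
split => [Cy x Cx|Cy].
  by rewrite -lee_fin (le_trans _ Cy)//; apply: ereal_sup_ubound; exists x.
by apply: ge_ereal_sup => _ [x Cx <-]; rewrite lee_fin Cy.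
Qed.

End ConvexBodies.

Section TensorProducts.
Variables (R : realType) (l : nat).

(* An operation assigning a set of the tensor product to each tuple of sets; it
   is only considered on convex bodies with 0 in the interior, its values on
   other sets being irrelevant. *)
Definition set_tensor := forall E : 'I_l -> euclideanType R,
  (forall i, set (E i)) -> set (tensor E).

Implicit Type alpha : set_tensor.

Definition tensor_pi : set_tensor := fun E P =>
  convex_hull [set pure x | x in [set x | forall i, P i (x i)]].

Definition dual_product alpha : set_tensor := fun E P =>
  polar (alpha E (fun i => polar (P i))).

Definition tensor_eps : set_tensor := dual_product tensor_pi.

Definition uniform_property alpha :=
  forall (E F : 'I_l -> euclideanType R) (T : forall i, {linear E i -> F i})
    (P : forall i, set (E i)) (Q : forall i, set (F i)),
    (forall i, convex_body0 (P i)) -> (forall i, convex_body0 (Q i)) ->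
    (forall i, T i @` P i `<=` Q i) ->
    tensor_map T @` alpha E P `<=` alpha F Q.

Definition tensor_product_of_bodies alpha :=
  [/\ forall E P, (forall i, convex_body0 (P i)) -> convex_body (alpha E P),
      forall E P, (forall i, convex_body0 (P i)) ->
        tensor_pi P `<=` alpha E P /\ alpha E P `<=` tensor_eps P
    & uniform_property alpha].

(* (P i) `&` (M i), as a set of the Euclidean space M i, is the preimage of P i
   by the inclusion; tensor_incl M embeds the tensor product of the M i. *)
Definition injective_product alpha :=
  forall (E : 'I_l -> euclideanType R) (P : forall i, set (E i))
    (M : forall i, {vspace E i}), (forall i, convex_body0 (P i)) ->
    @tensor_incl R l E M @` alpha (sub_spaces M) (fun i => vsval @^-1` P i) =
    alpha E P `&` tensor_sub M.

Definition projective_product alpha :=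
  forall (E F : 'I_l -> euclideanType R) (T : forall i, {linear E i -> F i})
    (P : forall i, set (E i)), (forall i, convex_body0 (P i)) ->
    (forall i, set_surj setT setT (T i)) ->
    tensor_map T @` alpha E P = alpha F (fun i => T i @` P i).

End TensorProducts.

(* Main.v *)
From HB Require Import structures.
Require Import Defs.
From mathcomp Require Import all_boot all_order all_algebra.
From mathcomp Require Import all_classical all_reals.
From mathcomp Require Import ereal topology normedtype convex derive.
From mathcomp Require Import ring lra.

(** The theorem is the tensor form of the fact that polarity exchanges quotients
    and sections: if [T] and [T'] are adjoint then the polar of an image [T @` C]
    is the preimage by [T'] of the polar of [C] ([polar_image]). The adjoint of a
    surjection is an injection and the adjoint of an inclusion is an orthogonal
    projection. The tensor product of the adjoints is the adjoint of the tensor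
    product of the maps ([tensor_map_adjoint]), so the principle applies to the
    factors and to the products alike.

    Both directions read an equality between bodies on the polars, which loses
    nothing by the bipolar theorem ([bipolar], a consequence of the separation of
    a point from a compact convex set by its nearest point). For this the bodies
    [alpha P] must contain [0]; they do because they contain the zero tensor,
    there being at least one factor ([tensor_product0]).

    If [alpha] is projective, applying this to the orthogonal projections onto
    subspaces makes its dual injective ([projective_dual_injective]). Conversely,
    injectivity of the dual speaks of inclusions of subspaces only, while the
    adjoints of surjections are arbitrary injections. The gap is an isomorphism
    onto the range, which the dual product respects because it inherits the
    uniform property ([dual_uniform]); see [dual_injective_projective]. *)

Set Implicit Arguments.
Unset Strict Implicit.
Unset Printing Implicit Defensive.

Import Order.TTheory GRing.Theory Num.Theory.
Import numFieldNormedType.Exports.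

Local Open Scope classical_set_scope.
Local Open Scope ring_scope.

(** * Norm, continuity and compactness in Euclidean spaces *)

Section EuclideanAnalysis.
Variables (R : realType) (E : euclideanType R).

Lemma inner_norm_le (x y : E) : '[x, y] <= `|x| * `|y|.
Proof.
have [->|y0] := eqVneq y 0; first by rewrite linear0r normr0 mulr0.
have ny : 0 < `|y| ^+ 2 by rewrite exprn_gt0 ?normr_gt0.
rewrite (le_trans (ler_norm _))// -(@ler_pXn2r _ 2)// ?nnegrE ?mulr_ge0//.
rewrite exprMn real_normK ?num_real//.
have := exprn_ge0 2 (normr_ge0 (`|y| ^+ 2 *: x - '[x, y] *: y)).
rewrite -inner_normE innerBl !innerBr !innerZl !innerZr !inner_normE (innerC y).
set a := `|x|; set b := '[x, y]; set c := `|y| ^+ 2.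
have -> : c * (c * a ^+ 2) - c * (b * b) - (b * (c * b) - b * (b * c)) =
  c * (a ^+ 2 * c - b ^+ 2) by ring.
by rewrite pmulr_rge0// subr_ge0.
Qed.

Lemma norm_inner_le (x y : E) : `|'[x, y]| <= `|x| * `|y|.
Proof.
rewrite ler_norml inner_norm_le andbT lerNl -mulN1r -innerZl scaleN1r.
by rewrite (le_trans (inner_norm_le _ _))// normrN.
Qed.

Lemma inner_inj (y z : E) :
  (forall x, '[x, y] = '[x, z]) -> y = z.
Proof.
move=> yz; apply/subr0_eq/eqP; apply: contraT => /inner_gt0.
by rewrite innerBr yz subrr ltxx.
Qed.

Lemma norm_onb (i : 'I_(\dim {:E})) : `|onb (E := E) i| = 1.
Proof.
by apply/eqP; rewrite -(@eqrXn2 _ 2)// -inner_normE onbP eqxx expr1n.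
Qed.

Lemma linear_normP (W : normedModType R) (f : {linear E -> W}) :
  exists2 k, 0 < k & forall x, `|f x| <= k * `|x|.
Proof.
exists (1 + \sum_i `|f (onb i)|) => [|x].
  by rewrite ltr_pwDl// sumr_ge0.
rewrite {1}(onb_sum x) linear_sum (le_trans (ler_norm_sum _ _ _))//.
rewrite mulrDl mul1r mulr_suml ler_wpDl// ler_sum// => i _.
rewrite linearZ normrZ mulrC ler_wpM2l//.
by rewrite (le_trans (norm_inner_le _ _))// norm_onb mulr1.
Qed.

Lemma linear_continuous (W : normedModType R) (f : {linear E -> W}) :
  continuous f.
Proof.
have [k k0 fk] := linear_normP f.
apply/bounded_linear_continuous/linear_boundedP.
exists k; split; first exact: gtr0_real.
by move=> r kr x; rewrite (le_trans (fk x))// ler_wpM2r// ltW.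
Qed.

Lemma inner_continuous (x : E) : continuous (fun y => '[x, y]).
Proof.
move=> y; apply/(@cvgrPdist_lt _ _ _ (nbhs y)) => e e0.
near=> z; rewrite -innerBr (le_lt_trans (norm_inner_le _ _))//.
rewrite (@le_lt_trans _ _ ((`|x| + 1) * `|y - z|))//.
  by rewrite ler_wpM2r// lerDl.
rewrite -ltr_pdivlMl ?ltr_pwDr//.
near: z; apply: cvgr_dist_lt => //.
by rewrite mulr_gt0// invr_gt0 ltr_pwDr.
Unshelve. all: by end_near. Qed.

(** Heine-Borel, transported from row vectors by the coordinates in the
    orthonormal basis. *)
Lemma bounded_closed_compact_euclidean (C : set E) (k : R) :
  closed C -> (forall x, C x -> `|x| <= k) -> compact C.
Proof.
move=> Ccl Ck.
pose g (v : 'rV[R]_(\dim {:E})) : E := \sum_i v ord0 i *: onb i.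
have gc : continuous g.
  apply: continuous_big => [|i _ v]; first exact: add_continuous.
  by apply: (@cvgZr_tmp _ _ _ (nbhs v)); exact: coord_continuous.
pose crd x : 'rV[R]_(\dim {:E}) := \row_i '[x, onb i].
have crdK x : g (crd x) = x.
  by rewrite {2}(onb_sum x); apply: eq_bigr => i _; rewrite mxE.
have gK v : crd (g v) = v.
  apply/rowP => i; rewrite mxE inner_suml (bigD1 i)//= big1 => [|j ji].
    by rewrite innerZl onbP eqxx mulr1 addr0.
  by rewrite innerZl onbP (negbTE ji) mulr0.
have -> : C = g @` (g @^-1` C).
  apply/seteqP; split=> [x Cx|_ [v Cv <-]//].
  by exists (crd x); rewrite /= ?crdK.
apply: continuous_compact; first exact: continuous_subspaceT.
apply: bounded_closed_compact; last by move/continuous_closedP : gc; exact.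
exists (Num.max 0 k); split=> [|k' /ltW kk' v /= Cv]; first exact: num_real.
rewrite (le_trans _ kk')// -(gK v) [leLHS]/Num.norm /= mx_normrE.
apply: bigmax_le; first by rewrite le_max lexx.
move=> [i j] _ /=; rewrite mxE le_max; apply/orP; right.
rewrite (le_trans (norm_inner_le _ _))// norm_onb mulr1; exact: Ck.
Qed.

Lemma convex_setP (C : set E) : convex_set C <->
  forall x y t, 0 <= t -> t <= 1 -> C x -> C y -> C (t *: x + (1 - t) *: y).
Proof.
split=> [Cc x y t t0 t1 Cx Cy|Cc x y t]; last first.
  by rewrite !inE => Cx Cy; apply: Cc.
by have := Cc x y (Itv01 t0 t1); rewrite !inE; apply.
Qed.

Lemma interior0P (C : set E) :
  C° 0 <-> exists2 r, 0 < r & forall x, `|x| <= r -> C x.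
Proof.
split=> [/nbhs_norm0P[r /= r0 rC]|[r r0 rC]].
  exists (r / 2) => [|x xr]; first by rewrite divr_gt0.
  by apply: rC => /=; rewrite (le_lt_trans xr)// gtr_pMr// invf_lt1// ltr1n.
by apply/nbhs_norm0P; exists r => //= x /ltW; exact: rC.
Qed.

(** The workable form of the notion: compactness becomes closedness and a bound,
    and the interior condition becomes a ball, so that polarity just exchanges
    the bound and the ball. *)
Lemma convex_body0P (C : set E) : convex_body0 C <->
  [/\ convex_set C, closed C, exists k, forall x, C x -> `|x| <= k
    & exists2 r, 0 < r & forall x, `|x| <= r -> C x].
Proof.
split=> [[[Cc Ck _] /interior0P C0]|[Cc Ccl [k Ck] C0]].
  split=> //; first by apply: compact_closed => //; exact: norm_hausdorff.
  have [k [_ kC]] := compact_bounded Ck.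
  by exists (k + 1) => x; apply: kC; rewrite ltrDl.
have {}C0 := (interior0P C).2 C0.
split=> //; split=> //; last by exists 0.
exact: bounded_closed_compact_euclidean Ck.
Qed.

End EuclideanAnalysis.

(** * Polarity and the bipolar theorem *)

Section Polar.
Variables (R : realType) (E : euclideanType R).
Implicit Types C : set E.

Lemma subset_polar C D : C `<=` D -> polar D `<=` polar C.
Proof. by move=> CD y /polarP Dy; apply/polarP => x /CD; exact: Dy. Qed.

Lemma polar_convex C : convex_set (polar C).
Proof.
apply/convex_setP => x y t t0 t1 /polarP Cx /polarP Cy; apply/polarP => z Cz.
rewrite innerDr !innerZr -[leRHS](subrKC t); apply: lerD.
  by rewrite ler_piMr// Cx.
by rewrite ler_piMr ?subr_ge0// Cy.
Qed.

Lemma polar_closed C : closed (polar C).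
Proof.
have -> : polar C = \bigcap_(x in C) [set y | '[x, y] <= 1].
  by apply/seteqP; split=> y /polarP.
apply: closed_bigI => x _.
apply: (@preimage_closed _ _ (fun y => '[x, y]) [set t | t <= 1]).
  by move=> y _; exact: inner_continuous.
exact: closed_le.
Qed.

Lemma polar0 C : polar C 0.
Proof. by apply/polarP => x _; rewrite linear0r. Qed.

(** If the ball of radius [r] lies in [C], testing the polar condition on
    [(r / `|y|) *: y] gives [`|y| <= r^-1]; if [k] bounds [C], the ball of radius
    [k^-1] lies in the polar by Cauchy-Schwarz. *)
Lemma polar_convex_body0 C : convex_body0 C -> convex_body0 (polar C).
Proof.
move=> /convex_body0P[_ _ [k Ck] [r r0 rC]]; apply/convex_body0P; split.
- exact: polar_convex.
- exact: polar_closed.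
- exists r^-1 => y /polarP Cy; have [->|y0] := eqVneq y 0.
    by rewrite normr0 invr_ge0 ltW.
  have ny : 0 < `|y| by rewrite normr_gt0.
  have := Cy ((r / `|y|) *: y); rewrite innerZl inner_normE expr2 mulrA.
  rewrite divfK ?lt0r_neq0// => h; rewrite -[leRHS]mul1r ler_pdivlMr// mulrC.
  apply/h/rC; rewrite normrZ gtr0_norm ?divr_gt0//.
  by rewrite divfK ?lt0r_neq0.
(* the bound k need not be positive *)
- have k1 : 0 < Num.max k 1 by rewrite lt_max ltr01 orbT.
  exists (Num.max k 1)^-1 => [|y yk]; first by rewrite invr_gt0.
  apply/polarP => x Cx; rewrite (le_trans (inner_norm_le _ _))//.
  rewrite -[leRHS](mulfV (lt0r_neq0 k1)).
  by rewrite ler_pM// le_max Ck.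
Qed.

Lemma inner_subZ (y w : E) t :
  '[y - t *: w, y - t *: w] = '[y, y] - 2 * (t * '[w, y]) + t * (t * '[w, w]).
Proof. by rewrite innerBl !innerBr !innerZl !innerZr (innerC y); ring. Qed.

(** The separating functional is [y = x - p] for [p] the point of [C] nearest
    to [x]; since [0] lies in [C], the threshold can be taken positive, and so
    scaled to [1] in the definition of the polar. *)
Lemma strict_separation C x : convex_set C -> compact C -> C 0 -> ~ C x ->
  exists y s, [/\ 0 < s, forall c, C c -> '[c, y] <= s & s < '[x, y]].
Proof.
move=> /convex_setP Ccvx Ck C0 Cx.
have [p] : exists2 p, p \in C & forall c, c \in C -> `|x - p| <= `|x - c|.
  apply: compact_EVT_min => //; first by exists 0.
  apply: continuous_subspaceT => z; apply: cvg_norm.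
  by apply: (@cvgB _ _ _ (nbhs z)); [exact: cvg_cst|exact: cvg_id].
rewrite inE => Cp pmin; pose y := x - p.
have yy : 0 < '[y, y].
  by apply: inner_gt0; rewrite subr_eq0; apply: contra_notN Cx => /eqP ->.
(* Otherwise moving from p towards c by t, the minimiser of the squared distance
   along the line truncated at 1 to stay in C, would come closer to x. *)
have Cy c : C c -> '[c - p, y] <= 0.
  move=> Cc; rewrite leNgt; apply/negP => cy.
  have cp0 : 0 < '[c - p, c - p].
    by apply: inner_gt0; apply: contraTneq cy => ->; rewrite linear0l ltxx.
  pose t := Num.min 1 ('[c - p, y] / '[c - p, c - p]).
  have t0 : 0 < t by rewrite lt_min ltr01 divr_gt0.
  have t1 : t <= 1 by rewrite ge_min lexx.
  have tcp : t * '[c - p, c - p] <= '[c - p, y].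
    by rewrite -ler_pdivlMr// ge_min lexx orbT.
  have := pmin _ (mem_set (Ccvx c p t (ltW t0) t1 Cc Cp)).
  have -> : x - (t *: c + (1 - t) *: p) = y - t *: (c - p).
    rewrite /y scalerBl scale1r scalerBr !opprD !opprK -!addrA.
    by congr (_ + _); rewrite addrCA.
  rewrite -/y -(@ler_pXn2r _ 2)// ?nnegrE// -!inner_normE.
  rewrite inner_subZ.
  have ta := mulr_gt0 t0 cy; have := ler_wpM2l (ltW t0) tcp.
  by lra.
exists y, ('[p, y] + '[y, y] / 2); split=> [|c /Cy|].
- rewrite ltr_wpDl ?divr_gt0//.
  by have := Cy _ C0; rewrite innerBl linear0l sub0r oppr_le0.
- by rewrite innerBl subr_le0 => /le_trans; apply; rewrite lerDl divr_ge0// ltW.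
- have -> : '[x, y] = '[p, y] + '[y, y] by rewrite -innerDl subrKC.
  by rewrite ltrD2l gtr_pMr// invf_lt1// ltr1n.
Qed.

Lemma bipolar C : convex_set C -> compact C -> C 0 -> polar (polar C) = C.
Proof.
move=> Ccvx Ck C0; apply/seteqP; split=> [x /polarP Cx|x Cx]; last first.
  by apply/polarP => y /polarP; rewrite innerC; exact.
apply: contrapT => /(strict_separation Ccvx Ck C0)[y [s [s0 Cy]]].
apply/negP; rewrite -leNgt -[leRHS]mulr1 mulrC -ler_pdivrMr// mulrC.
rewrite innerC -innerZl; apply: Cx; apply/polarP => c Cc.
by rewrite innerZr ler_pdivrMl// mulr1 Cy.
Qed.

Lemma polar_inj C D : convex_set C -> compact C -> C 0 ->
  convex_set D -> compact D -> D 0 -> polar C = polar D -> C = D.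
Proof.
by move=> *; rewrite -[C]bipolar// -[D]bipolar//; congr polar.
Qed.

Lemma bipolar_body C : convex_body0 C -> polar (polar C) = C.
Proof. by case=> -[Cc Ck _] /interior_subset C0; exact: bipolar. Qed.

End Polar.

(** * Adjoint maps *)

(** This is the engine of the duality: polarity turns images by a map into
    preimages by its adjoint. *)
Lemma polar_image (R : realType) (E F : euclideanType R) (T : E -> F)
    (T' : F -> E) (C : set E) :
  (forall x y, '[T x, y] = '[x, T' y]) -> polar (T @` C) = T' @^-1` polar C.
Proof.
move=> TT'; apply/seteqP; split=> y /polarP Cy; apply/polarP.
  by move=> x Cx; rewrite -TT'; apply: Cy; exists x.
by move=> _ [x Cx <-]; rewrite TT'; exact: Cy.
Qed.

Section Adjoint.
Variables (R : realType) (E F : euclideanType R) (T : {linear E -> F}).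

Definition adjoint (y : F) : E := \sum_i '[y, T (onb i)] *: onb i.

Let adjoint_linear : linear adjoint.
Proof.
move=> a y z; rewrite /adjoint scaler_sumr -big_split; apply: eq_bigr => i _.
by rewrite innerDl innerZl scalerDl scalerA.
Qed.

HB.instance Definition _ := GRing.isLinear.Build R F E _ adjoint adjoint_linear.

Lemma adjointP x y : '[T x, y] = '[x, adjoint y].
Proof.
rewrite {1}(onb_sum x) linear_sum inner_suml inner_sumr; apply: eq_bigr => i _.
by rewrite linearZ innerZl innerZr (innerC y) mulrC.
Qed.

(** Informative, so that a right inverse can be chosen for every map of a
    family. *)
Lemma surj_right_inverse : set_surj setT setT T ->
  {S : {linear F -> E} | cancel S T}.
Proof.
move=> Ts; exists ((linfun T)^-1)%VF => y.
rewrite -[LHS](lfunE T) limg_lfunVK//.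
have [x _ <-] := Ts y I.
by rewrite -[T x](lfunE T) memv_img ?memvf.
Qed.

End Adjoint.

(** * Images and sections of convex bodies *)

Section Image.
Variables (R : realType) (E F : euclideanType R) (T : {linear E -> F}).

Lemma convex_image (C : set E) : convex_set C -> convex_set (T @` C).
Proof.
move=> /convex_setP Cc; apply/convex_setP.
move=> _ _ t t0 t1 [x Cx <-] [y Cy <-].
by exists (t *: x + (1 - t) *: y); rewrite ?linearD ?linearZ//; exact: Cc.
Qed.

Lemma compact_image (C : set E) : compact C -> compact (T @` C).
Proof.
move=> Ck; apply: continuous_compact => //.
exact/continuous_subspaceT/linear_continuous.
Qed.

End Image.

(** The interior is where surjectivity enters: a bounded linear right inverse of
    [T] pulls small balls of the target back into a ball contained in [C]. *)
Lemma surj_image_convex_body0 (R : realType) (E F : euclideanType R)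
    (T : {linear E -> F}) (C : set E) :
  set_surj setT setT T -> convex_body0 C -> convex_body0 (T @` C).
Proof.
move=> Ts C0; have [S SK] := surj_right_inverse Ts.
have [[Cc Ck _] _] := C0.
have [_ _ _ [r r0 rC]] := (convex_body0P C).1 C0.
have [k k0 Sk] := linear_normP S.
have C0' : (T @` C)° 0.
  apply/interior0P; exists (r / k) => [|y yr]; first exact: divr_gt0.
  exists (S y) => //; apply: rC; rewrite (le_trans (Sk y))//.
  by rewrite mulrC -ler_pdivlMr.
by split=> //; split; [exact: convex_image|exact: compact_image|exists 0].
Qed.

Lemma subspace_convex_body0 (R : realType) (E : euclideanType R)
    (M : {vspace E}) (C : set E) :
  convex_body0 C -> convex_body0 (vsval @^-1` C : set (subvs_of M)).
Proof.
have vsN (x : subvs_of M) : `|vsval x| = `|x|.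
  by apply/eqP; rewrite -(@eqrXn2 _ 2)// -!inner_normE.
move=> /convex_body0P[/convex_setP Cc Ccl [k Ck] [r r0 rC]].
apply/convex_body0P; split.
- apply/convex_setP => x y t t0 t1 Cx Cy.
  by have := Cc _ _ t t0 t1 Cx Cy; rewrite -!linearZ -linearD.
- apply: preimage_closed => // x _; exact: linear_continuous.
- by exists k => x /Ck; rewrite vsN.
- by exists r => // x xr; apply: rC; rewrite vsN.
Qed.

(** * Functoriality of the tensor product of maps *)

Section TensorMaps.
Variables (R : realType) (l : nat).

Lemma tensor_map_adjoint (E F : 'I_l -> euclideanType R)
    (T : forall i, {linear E i -> F i}) (T' : forall i, {linear F i -> E i}) :
  (forall i x y, '[T i x, y] = '[x, T' i y]) ->
  forall z w, '[tensor_map T z, w] = '[z, tensor_map T' w].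
Proof.
move=> TT' z w; rewrite [in LHS](tensor_sum_pure w) [in RHS](tensor_sum_pure z).
rewrite /tensor_map inner_sumr inner_suml.
under eq_bigr do rewrite inner_suml; under [RHS]eq_bigr do rewrite inner_sumr.
rewrite exchange_big; apply: eq_bigr => j _; apply: eq_bigr => k _.
rewrite !innerZl !innerZr !inner_pure; congr (_ * (_ * _)).
by apply: eq_bigr => i _.
Qed.

Lemma tensor_map_comp (E F G : 'I_l -> euclideanType R)
    (S : forall i, {linear F i -> G i}) (T : forall i, {linear E i -> F i})
    (U : forall i, {linear E i -> G i}) :
  (forall i x, S i (T i x) = U i x) ->
  forall z, tensor_map S (tensor_map T z) = tensor_map U z.
Proof.
move=> STU z; rewrite [tensor_map T z]/tensor_map linear_sum.
apply: eq_bigr => j _; rewrite linearZ_LR /= tensor_map_pure.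
congr (_ *: _); apply/ffunP => k; rewrite !pureE.
by under eq_bigr do rewrite STU.
Qed.

Lemma tensor_mapK (E F : 'I_l -> euclideanType R)
    (S : forall i, {linear F i -> E i}) (T : forall i, {linear E i -> F i}) :
  (forall i, cancel (T i) (S i)) -> cancel (tensor_map T) (tensor_map S).
Proof.
move=> TK z; rewrite (tensor_map_comp (U := fun i => idfun)) => [|i x].
  exact/esym/tensor_sum_pure.
exact: TK.
Qed.

End TensorMaps.

(** * Duality of projective and injective products *)

Section Duality.
Variables (R : realType) (l : nat) (l_gt0 : (0 < l)%N) (alpha : set_tensor R l).
Hypothesis alphaP : tensor_product_of_bodies alpha.
Implicit Types E F : 'I_l -> euclideanType R.

(** The tensor of zero vectors is zero only when there is at least one factor;
    for an empty product it is the scalar [1], and [alpha P] could miss [0]. *)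
Lemma tensor_product0 E (P : forall i, set (E i)) :
  (forall i, convex_body0 (P i)) -> alpha P 0.
Proof.
move=> P0; have [_ /(_ E P P0)[piP _] _] := alphaP; apply: piP.
apply: sub_gen_smallest; exists (fun=> 0).
  by move=> i; apply: interior_subset; case: (P0 i).
apply/ffunP => j; rewrite pureE ffunE (bigD1 (Ordinal l_gt0))//= linear0l.
by rewrite mul0r.
Qed.

Lemma polar_tensor_product E (P : forall i, set (E i)) :
  (forall i, convex_body0 (P i)) ->
  polar (alpha P) = dual_product alpha (fun i => polar (P i)).
Proof.
move=> P0; rewrite /dual_product; congr (polar (alpha _)).
by apply/functional_extensionality_dep => i; rewrite bipolar_body.
Qed.

(** If [T i] maps [P i] into [Q i], its adjoint maps the polar of [Q i] into the
    polar of [P i]; so the uniform property of [alpha] for the adjoints is, after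
    polarity, the one of the dual product for the [T i]. *)
Lemma dual_uniform : uniform_property (dual_product alpha).
Proof.
have [_ _ alphaU] := alphaP; move=> E F T P Q P0 Q0 TPQ _ [z zP <-].
pose T' i : {linear F i -> E i} := adjoint (T i).
have adjT : forall i x y, '[T i x, y] = '[x, T' i y].
  by move=> i x y; exact: adjointP.
apply/polarP => w wQ; rewrite innerC (tensor_map_adjoint adjT) innerC.
move/polarP : zP; apply; apply: (alphaU _ _ T' (fun i => polar (Q i))).
- by move=> i; exact: polar_convex_body0.
- by move=> i; exact: polar_convex_body0.
- move=> i _ [y Qy <-].
  have : polar (T i @` P i) y by exact: subset_polar (TPQ i) _ Qy.
  by rewrite (polar_image _ (adjT i)).
- by exists w.
Qed.

(** The adjoint of the inclusion [J i] of [M i] is the orthogonal projection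
    [T i] onto [M i]. By bipolarity the polar in [M i] of the section of [P i] is
    the projection of the polar of [P i], and projectivity of [alpha] moves these
    projections outside the product. *)
Lemma projective_dual_injective :
  projective_product alpha -> injective_product (dual_product alpha).
Proof.
move=> alpha_proj E P M P0.
pose J i : {linear sub_spaces M i -> E i} := @vsval _ _ (M i).
pose T i : {linear E i -> sub_spaces M i} := adjoint (J i).
have adjT i x y : '[T i x, y] = '[x, J i y].
  by rewrite innerC -adjointP innerC.
have Tsurj i : set_surj setT setT (T i).
  move=> y _; exists (J i y) => //; apply/subr0_eq/eqP.
  apply: contraT => /inner_gt0; rewrite {1}innerBl adjT.
  by rewrite /J -sub_innerE subrr ltxx.
have P'0 i : convex_body0 (polar (P i)) by exact: polar_convex_body0.
have polarT : (fun i => polar (J i @^-1` P i)) = (fun i => T i @` polar (P i)).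
  apply/functional_extensionality_dep => i.
  rewrite -[P i in LHS](bipolar_body (P0 i)) -(polar_image _ (adjT i)).
  have [[Pc Pk _] _] := P'0 i; apply: bipolar.
  - exact: convex_image.
  - exact: compact_image.
  - by exists 0; rewrite ?linear0//; exact: polar0.
have -> : dual_product alpha (fun i => vsval @^-1` P i) =
    tensor_incl (M := M) @^-1` dual_product alpha P.
  rewrite /dual_product [X in alpha X]polarT -alpha_proj//.
  exact: polar_image (tensor_map_adjoint adjT).
rewrite tensor_subE; apply/seteqP; split=> [_ [z Pz <-]|z [Pz [w _ wz]]].
  by split=> //; exists z.
by exists w => //=; rewrite wz.
Qed.

(** Both sides are compact convex sets containing [0], so it is enough to compare
    their polars, which are the preimage by [tensor_map J] of the dual product of
    the polars [P' i], and the dual product of the preimages [J i @^-1` P' i],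
    for [J i] the adjoint of [T i]. Injectivity gives this equality for inclusions
    of subspaces; a general [J i] is injective, with left inverse [L i], hence an
    isomorphism onto its range [M i], and the uniform property transports the
    equality along it in both directions. *)
Lemma dual_injective_projective :
  injective_product (dual_product alpha) -> projective_product alpha.
Proof.
move=> alpha_inj E F T P P0 Tsurj.
have TP0 i : convex_body0 (T i @` P i) by exact: surj_image_convex_body0.
pose J i : {linear F i -> E i} := adjoint (T i).
have adjT : forall i x y, '[T i x, y] = '[x, J i y].
  by move=> i x y; exact: adjointP.
pose S i := sval (surj_right_inverse (Tsurj i)).
pose L i : {linear E i -> F i} := adjoint (S i).
have JK i : cancel (J i) (L i).
  move=> y; apply: inner_inj => x.
  rewrite -adjointP -adjT; congr ('[_, _]).
  exact: (svalP (surj_right_inverse (Tsurj i))).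
pose P' i := polar (P i).
have P'0 i : convex_body0 (P' i) by exact: polar_convex_body0.
have polarT i : polar (T i @` P i) = J i @^-1` P' i.
  exact: polar_image (adjT i).
have JP'0 i : convex_body0 (J i @^-1` P' i).
  by rewrite -polarT; exact: polar_convex_body0.
have [alpha_body _ _] := alphaP.
apply: polar_inj.
- by apply: convex_image; case: (alpha_body E P P0).
- by apply: compact_image; case: (alpha_body E P P0).
- by exists 0; [exact: tensor_product0|exact: linear0].
- by case: (alpha_body F _ TP0).
- by case: (alpha_body F _ TP0).
- exact: tensor_product0.
rewrite (polar_image _ (tensor_map_adjoint adjT)) !polar_tensor_product//.
rewrite (functional_extensionality_dep polarT) -/P'.
apply/seteqP; split=> [w /= Jw|w Jw]; last first.
  apply: (dual_uniform JP'0 P'0); last by exists w.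
  by move=> i _ [y Jy <-].
pose M i := limg (linfun (J i)).
have JM i y : J i y \in M i by rewrite -[J i y]lfunE memv_img ?memvf.
have : (dual_product alpha P' `&` tensor_sub M) (tensor_map J w).
  split=> // V MV; apply: memv_suml => j _; apply: memvZ.
  by apply: MV => i; exact: JM.
rewrite -alpha_inj// => -[z Mz zw].
have incl_body0 i : convex_body0 (vsval @^-1` P' i : set (sub_spaces M i)).
  exact: subspace_convex_body0.
pose K i : {linear sub_spaces M i -> F i} := L i \o vsval.
have <- : tensor_map K z = w.
  rewrite -[RHS](tensor_mapK JK) -zw.
  by rewrite (@tensor_map_comp _ _ _ _ _ _ _ K).
apply: (dual_uniform incl_body0 JP'0); last by exists z.
move=> i _ [m Pm <-]; have /memv_imgP[y _] : vsval m \in M i by exact: subvsP.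
by rewrite lfunE => my; rewrite /= my JK -my.
Qed.

End Duality.

Theorem theorem2p12 (R : realType) (l : nat) (l_gt0 : (0 < l)%N)
    (alpha : set_tensor R l) (alphaP : tensor_product_of_bodies alpha) :
  projective_product alpha <-> injective_product (dual_product alpha).
Proof.
split; first exact: projective_dual_injective.
exact: dual_injective_projective.
Qed.
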